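(* Let $\{A_n\}_{n=0}^{\infty}$ be a family of measurable sets with the following properties: (1) $A_i\cap A_j=\emptyset$ if $i\ne j$; (2) $\bigcup_{n=0}^{\infty}A_n=(0,1)$; (3) $\mu(A_n)>0$ for all $n$ and $\mu(A_n)\to0$ as $n\to\infty$. Fix any $1\le p<\infty$ and consider the projections $P_n$ in $L_p(0,1)$ defined, for every $f\in L_p(0,1)$, by $P_nf(t)=f(t)$ for $t\in A_n$ and $P_nf(t)=0$ otherwise. Then $\{P_nL_p(0,1)\}_{n=0}^{\infty}$ is a Schauder-Orlicz decomposition with the Orlicz function $t^p$ of $L_p(0,1)$.
   Context: $\mu$ is Lebesgue measure on $(0,1)$. A Schauder decomposition of a Banach space $X$ is a sequence $\{\mathfrak{M}_n\}_{n=0}^{\infty}$ of closed nonzero linear subspaces of $X$ such that each $x\in X$ has a unique norm convergent expansion $x=\sum_{n=0}^{\infty}x_n$ with $x_n\in\mathfrak{M}_n$ for all $n$. Its associated sequence of coordinate projections (a.s.c.p.) $\{P_n\}_{n=0}^{\infty}$ is defined by $P_nx=x_n$; each $P_n$ is bounded. An Orlicz function is a continuous, nondecreasing, convex function $\Phi:[0,\infty)\to[0,\infty)$ with $\Phi(0)=0$ and $\lim_{t\to\infty}\Phi(t)=\infty$. A Schauder decomposition of $X$ with a.s.c.p. $\{P_n\}$ is a Schauder-Orlicz decomposition with Orlicz function $\Phi$ if for every $x\in X$: $\inf\{\rho>0:\sum_{n=0}^{\infty}\Phi(\|P_nx\|/\rho)\le 1\}=\|x\|$. *)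

(* Defs.v *)
From HB Require Import structures.
From mathcomp Require Import all_boot all_order all_algebra.
From mathcomp Require Import all_classical all_reals all_analysis.
From mathcomp Require Import measurable_realfun ess_sup_inf.
From mathcomp Require Import lra.

Set Implicit Arguments.
Unset Strict Implicit.
Unset Printing Implicit Defensive.

Import Order.TTheory GRing.Theory Num.Def Num.Theory.
Import numFieldNormedType.Exports.

Local Open Scope classical_set_scope.
Local Open Scope ring_scope.

(* The library provides the type LspaceType of classes of L^p functions modulo
   almost everywhere equality, but no structure on it. It is made here into a
   normed space for the norm 'N[mu]_p, complete when p is finite. A class f
   coerces to a function, which is one of its representatives. *)

Section Lspace_class.
Context d (T : measurableType d) (R : realType).
Variables (mu : {measure set T -> \bar R}) (p : \bar R) (p1 : (1 <= p)%E).

Local Notation Lfunction := (LfunType mu p1).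
Local Notation Lspace := (LspaceType mu p1).
Local Notation Q := {mfun_ mu, T >-> measurableTypeR R}.

Lemma ae_eq_Lnorm (f g : T -> R) :
  measurable_fun setT f -> measurable_fun setT g -> f = g %[ae mu] ->
  ('N[mu]_p[EFin \o f] = 'N[mu]_p[EFin \o g])%E.
Proof.
move=> mf mg fg; rewrite unlock /Lnorm; case: p => [r| |].
- have mP (h : T -> R) : measurable_fun [set: T] h ->
      measurable_fun [set: T] (fun x => `|(EFin \o h) x| `^ r)%E.
    move=> mh.
    apply: (@measurableT_comp _ _ _ _ _ _ (fun x : \bar R => x `^ r)%E) => //=.
      exact: (measurableT_comp (measurable_poweR _)).
    by apply: measurableT_comp => //; exact: measurableT_comp.
  congr (_ `^ _)%E; apply: ge0_ae_eq_integral => //.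
  + exact: mP.
  + exact: mP.
  + by move=> x _; exact: poweR_ge0.
  + by move=> x _; exact: poweR_ge0.
  + by apply: filterS fg => x /= + _ => /(_ I) ->.
- case: ifP => // _; apply: eq_ess_sup.
  by apply: filterS fg => x /= /(_ I) ->.
- case: ifP => // _; apply: eq_ess_inf.
  by apply: filterS fg => x /= /(_ I) ->.
Qed.

(* LspaceType is built on functions into measurableTypeR R, i.e., R with the same
   sigma-algebra but another measure_display. *)
Definition mfunR (f : Lfunction) : {mfun T >-> measurableTypeR R} :=
  HB.pack_for {mfun T >-> measurableTypeR R} (f : T -> measurableTypeR R)
    (@isMeasurableFun.Build _ _ T (measurableTypeR R) f (@measurable_funPT _ _ _ _ f)).

Definition ae_class (f : Lfunction) : Q := (\pi_Q (mfunR f))%qT.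

Lemma measurable_ae_class (f : Q) : measurable_fun [set: T] (f : T -> R).
Proof.
by move=> m B mB; exact: (@measurable_funPT _ _ _ _ (repr f) m B mB).
Qed.

Lemma ae_classE (f : Lfunction) : (ae_class f : T -> R) = f %[ae mu].
Proof.
have /eqmodP/asboolP : (\pi_Q (repr (ae_class f)) = ae_class f)%qT by rewrite reprK.
exact.
Qed.

Fact Lclass_subproof (f : Lfunction) : finite_norm mu p (ae_class f).
Proof.
rewrite /finite_norm (ae_eq_Lnorm _ _ (ae_classE f)) //.
- exact: Lfunction_finite.
- exact: measurable_ae_class.
Qed.

Definition Lclass (f : Lfunction) : Lspace :=
  HB.pack_for Lspace (ae_class f)
   (@isFinLebesgue.Build _ _ _ _ _ p1 _ (Lclass_subproof f)).

Fact Lrepr_subproof (f : Lspace) : (f : T -> R) \in Lfun mu p.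
Proof.
rewrite inE; apply/andP; split; apply: mem_set => /=.
- exact: measurable_ae_class.
- exact: Lebesgue_finite.
Qed.

Definition Lrepr (f : Lspace) : Lfunction := Lfun_Sub p1 (Lrepr_subproof f).

Lemma LclassE (f : Lfunction) : (Lclass f : T -> R) = f %[ae mu].
Proof. exact: ae_classE. Qed.

Lemma Lspace_eqP (f g : Lspace) : (f : T -> R) = g %[ae mu] <-> f = g.
Proof.
split=> [fg|->]; last exact: ae_eq_refl.
case: f g fg => f [[Hf]] [g [[Hg]]] /= fg.
have E : f = g.
  rewrite -(reprK f) -(reprK g); apply/eqmodP/asboolP; exact: fg.
by subst g; rewrite (Prop_irrelevance Hf Hg).
Qed.

Lemma Lrepr_ae (f : Lspace) : Lclass (Lrepr f) = f.
Proof. by apply/Lspace_eqP; exact: LclassE. Qed.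

Lemma eq_Lclass (f g : Lfunction) :
  (f : T -> R) = g %[ae mu] -> Lclass f = Lclass g.
Proof.
move=> fg; apply/Lspace_eqP/(ae_eq_trans (LclassE f)).
by apply: (ae_eq_trans fg); apply: ae_eq_sym; exact: LclassE.
Qed.

End Lspace_class.

Section Lspace_lmodule.
Context d (T : measurableType d) (R : realType).
Variables (mu : {measure set T -> \bar R}) (p : \bar R) (p1 : (1 <= p)%E).

Local Notation Lfunction := (LfunType mu p1).
Local Notation Lspace := (LspaceType mu p1).
Implicit Types (f g h : Lspace) (a b : R) (u v : Lfunction).

HB.instance Definition _ := gen_eqMixin Lspace.
HB.instance Definition _ := gen_choiceMixin Lspace.

Definition Lspace_zero : Lspace := Lclass (0 : Lfunction).
Definition Lspace_opp f : Lspace := Lclass (- Lrepr f).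
Definition Lspace_add f g : Lspace := Lclass (Lrepr f + Lrepr g).
Definition Lspace_scale a f : Lspace := Lclass (a *: Lrepr f).

Let addE u v : Lspace_add (Lclass u) (Lclass v) = Lclass (u + v).
Proof.
by apply: eq_Lclass; apply: filterS2 (LclassE u) (LclassE v) => x /= ux vx _;
  exact: (congr2 +%R (ux I) (vx I)).
Qed.

Let oppE u : Lspace_opp (Lclass u) = Lclass (- u).
Proof.
by apply: eq_Lclass; apply: filterS (LclassE u) => x /= ux _;
  exact: (congr1 -%R (ux I)).
Qed.

Let scaleE a u : Lspace_scale a (Lclass u) = Lclass (a *: u).
Proof.
by apply: eq_Lclass; apply: filterS (LclassE u) => x /= ux _;
  exact: (congr1 ( *%R a) (ux I)).
Qed.

Let addA : associative Lspace_add.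
Proof.
by move=> f g h; rewrite -(Lrepr_ae f) -(Lrepr_ae g) -(Lrepr_ae h) !addE addrA.
Qed.

Let addC : commutative Lspace_add.
Proof. by move=> f g; rewrite -(Lrepr_ae f) -(Lrepr_ae g) !addE addrC. Qed.

Let add0 : left_id Lspace_zero Lspace_add.
Proof. by move=> f; rewrite -(Lrepr_ae f) !addE add0r. Qed.

Let addN : left_inverse Lspace_zero Lspace_opp Lspace_add.
Proof. by move=> f; rewrite -(Lrepr_ae f) oppE addE addNr. Qed.

HB.instance Definition _ := GRing.isZmodule.Build Lspace addA addC add0 addN.

Let scaleA a b f : Lspace_scale a (Lspace_scale b f) = Lspace_scale (a * b) f.
Proof. by rewrite -(Lrepr_ae f) !scaleE scalerA. Qed.

Let scale1 : left_id 1 Lspace_scale.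
Proof. by move=> f; rewrite -(Lrepr_ae f) scaleE scale1r. Qed.

Let scaleDr : right_distributive Lspace_scale +%R.
Proof.
by move=> a f g; rewrite -(Lrepr_ae f) -(Lrepr_ae g) /GRing.add/= addE !scaleE
  addE scalerDr.
Qed.

Let scaleDl f : {morph Lspace_scale^~ f : a b / a + b}.
Proof.
by move=> a b; rewrite -(Lrepr_ae f) !scaleE [RHS]addE scalerDl.
Qed.

HB.instance Definition _ := GRing.Zmodule_isLmodule.Build R Lspace
  scaleA scale1 scaleDr scaleDl.

Lemma LclassD u v : Lclass (u + v) = Lclass u + Lclass v.
Proof. by rewrite -addE. Qed.

Lemma LclassN u : Lclass (- u) = - Lclass u.
Proof. by rewrite -oppE. Qed.

Lemma LclassZ a u : Lclass (a *: u) = a *: Lclass u.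
Proof. by rewrite -scaleE. Qed.

Definition Lspace_norm f : R := fine ('N[mu]_p[EFin \o (f : T -> R)])%E.

Lemma Lspace_normE u : (Lspace_norm (Lclass u))%:E = ('N[mu]_p[EFin \o u])%E.
Proof.
rewrite -finite_norm_fine; congr (fine _)%:E.
exact: ae_eq_Lnorm (measurable_ae_class _) _ (LclassE u).
Qed.

Let ler_normD f g : Lspace_norm (f + g) <= Lspace_norm f + Lspace_norm g.
Proof.
rewrite -(Lrepr_ae f) -(Lrepr_ae g) -LclassD -lee_fin EFinD !Lspace_normE.
by rewrite eminkowski.
Qed.

Let normrZ a f : Lspace_norm (a *: f) = `|a| * Lspace_norm f.
Proof.
apply: EFin_inj; rewrite -(Lrepr_ae f) -LclassZ EFinM !Lspace_normE.
exact: LnormZ.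
Qed.

Let normr0_eq0 f : Lspace_norm f = 0 -> f = 0.
Proof.
rewrite -(Lrepr_ae f) => N0; apply: eq_Lclass.
apply: fine_Lnormr_eq0; apply: EFin_inj.
by rewrite finite_norm_fine -Lspace_normE N0.
Qed.

HB.instance Definition _ := Lmodule_isNormed.Build R Lspace
  ler_normD normrZ normr0_eq0.

Lemma LspacenormE f : (`|f|%:E = 'N[mu]_p[EFin \o (f : T -> R)])%E.
Proof. by rewrite -{1}(Lrepr_ae f); exact: Lspace_normE. Qed.

End Lspace_lmodule.

Section Riesz_Fischer.
Context d (T : measurableType d) (R : realType).
Variables (mu : {measure set T -> \bar R}) (r : R) (r1 : (1 <= r%:E)%E).

Local Notation Lfunction := (LfunType mu r1).
Local Notation Lspace := (LspaceType mu r1).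
Local Notation "'N[ h ]" := ('N[mu]_r%:E[EFin \o (h%R : T -> R)])%E.

Let r_ge1 : 1 <= r. Proof. by rewrite -lee_fin. Qed.
Let r_gt0 : 0 < r. Proof. exact: lt_le_trans r_ge1. Qed.

Let powR_norm_continuous : continuous (fun x : R => `|x| `^ r).
Proof.
move=> x; have [->|x0] := eqVneq x 0.
  rewrite /continuous_at normr0 powR0 ?gt_eqF//.
  apply/cvgrPdist_lt => e e0; near=> y.
  rewrite sub0r normrN ger0_norm ?powR_ge0//.
  rewrite -[ltRHS]powRr1 ?ltW// -(mulVf (lt0r_neq0 r_gt0)) powRrM.
  apply: gt0_ltr_powR; rewrite ?nnegrE ?powR_ge0//.
  near: y; exists (e `^ r^-1) => /=; first by rewrite powR_gt0.
  by move=> y /=; rewrite sub0r normrN.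
have xgt0 : 0 < `|x| by rewrite normr_gt0.
apply: (@continuous_comp _ _ _ (fun y : R => `|y|) (fun y : R => y `^ r)).
  exact: norm_continuous.
apply: differentiable_continuous; apply/derivable1_diffP.
by apply: derivable_powR; rewrite in_itv/= andbT.
Unshelve. all: end_near. Qed.

Let mpow (h : T -> R) : measurable_fun [set: T] h ->
  measurable_fun [set: T] (fun x => (`|h x| `^ r)%:E).
Proof.
move=> mh; apply/measurable_EFinP.
apply: (@measurableT_comp _ _ _ _ _ _ (fun x : R => x `^ r)) => //.
exact: measurableT_comp.
Qed.

Let Lnorm_powE (h : T -> R) :
  ('N[h] `^ r = \int[mu]_x (`|h x| `^ r)%:E)%E.
Proof. by rewrite poweR_Lnorm ?gt_eqF//; apply: eq_integral. Qed.

Let Lnorm_le_pow (h : T -> R) (c : R) : 0 <= c -> ('N[h] <= c%:E)%E ->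
  (\int[mu]_x (`|h x| `^ r)%:E <= (c `^ r)%:E)%E.
Proof.
move=> c0 hc; rewrite -Lnorm_powE -poweR_EFin.
by apply: gt0_ler_poweR => //; rewrite ?ltW// in_itv/= ?leey ?andbT ?Lnorm_ge0 ?lee_fin.
Qed.

Let pow_le_Lnorm (h : T -> R) (c : R) : 0 <= c ->
  (\int[mu]_x (`|h x| `^ r)%:E <= (c `^ r)%:E)%E -> ('N[h] <= c%:E)%E.
Proof.
rewrite -Lnorm_powE => c0 hc.
have ir : r * r^-1 = 1 by rewrite mulfV// gt_eqF.
rewrite -(poweRe1 (Lnorm_ge0 _ _ _)) -ir poweRrM.
rewrite -[leRHS]poweRe1 ?lee_fin// -ir poweRrM.
apply: gt0_ler_poweR => //; first by rewrite invr_ge0 ltW.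
- by rewrite in_itv/= leey andbT poweR_ge0.
- by rewrite in_itv/= leey andbT lee_fin powR_ge0.
Qed.

Let fatou_bound (h : nat -> T -> R) (c : R) : 0 <= c ->
  (forall n, measurable_fun [set: T] (h n)) -> (forall n, 'N[h n] <= c%:E)%E ->
  (\int[mu]_x limn_einf (fun n => (`|h n x| `^ r)%:E) <= (c `^ r)%:E)%E.
Proof.
move=> c0 mh hc.
apply: (le_trans (fatou mu measurableT (fun n => mpow (mh n)) _)).
  by move=> n x _; rewrite lee_fin powR_ge0.
rewrite limn_einf_lim; apply: lime_le; first exact: is_cvg_einfs.
apply: nearW => n; apply: le_trans (Lnorm_le_pow c0 (hc n)).
by apply: ereal_inf_lbound; exists n => /=.
Qed.

Let measurable_einf_pow (h : nat -> T -> R) :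
  (forall n, measurable_fun [set: T] (h n)) ->
  measurable_fun [set: T] (fun x => limn_einf (fun n => (`|h n x| `^ r)%:E)).
Proof.
move=> mh; rewrite (_ : (fun x => _) =
    fun x => (- limn_esup (fun n => - (`|h n x| `^ r)%:E))%E) //.
apply: measurableT_comp => //; apply: measurable_fun_limn_esup => n.
by apply: measurableT_comp => //; exact: mpow.
Qed.

Let einf_pow_ge0 (h : nat -> T -> R) x :
  (0 <= limn_einf (fun n => (`|h n x| `^ r)%:E))%E.
Proof.
rewrite limn_einf_lim; apply: lime_ge; first exact: is_cvg_einfs.
apply: nearW => n; apply: le_ereal_inf_tmp => _ [k _ <-].
by rewrite lee_fin powR_ge0.
Qed.

Let fatou_Lnorm (h : nat -> T -> R) (g : T -> R) (c : R) : 0 <= c ->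
  (forall n, measurable_fun [set: T] (h n)) -> measurable_fun [set: T] g ->
  (forall n, 'N[h n] <= c%:E)%E -> {ae mu, forall x, h ^~ x @ \oo --> g x} ->
  ('N[g] <= c%:E)%E.
Proof.
move=> c0 mh mg hc hg; apply: pow_le_Lnorm => //.
apply: le_trans (fatou_bound c0 mh hc).
rewrite le_eqVlt; apply/orP; left; apply/eqP.
apply: ge0_ae_eq_integral => //.
- exact: mpow.
- exact: measurable_einf_pow.
- apply: filterS hg => x hgx _; apply/esym.
  suff /cvg_limn_einf_sup[] : (fun n => (`|h n x| `^ r)%:E) @ \oo --> (`|g x| `^ r)%:E by [].
  apply: cvg_EFin; first exact: nearW.
  apply: (@cvg_comp _ _ _ (h^~ x) (fun y : R => `|y| `^ r) _ _ _ hgx).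
  exact: powR_norm_continuous.
Qed.


Let ccauchy_cvg (u : nat -> Lspace) :
  (forall n, `|u n.+1 - u n| <= 2^-1 ^+ n) ->
  exists g : Lspace, forall n, `|g - u n| <= 2 * 2^-1 ^+ n.
Proof.
move=> u_cauchy.
pose U n : T -> R := u n.
have mU n : measurable_fun [set: T] (U n) by exact: measurable_ae_class.
have mUD m n : measurable_fun [set: T] (fun x => U m x - U n x).
  exact: measurable_funB.
have UDE m n : 'N[fun x => U m x - U n x] = `|u m - u n|%:E.
  rewrite -(Lrepr_ae (u m)) -(Lrepr_ae (u n)) -LclassN -LclassD.
  by rewrite [RHS]Lspace_normE.
have half k : 2 * 2^-1 ^+ k.+1 = 2^-1 ^+ k :> R.
  by rewrite exprS mulrA mulfV ?mul1r.
have norm_tail n m : `|u (n + m)%N - u n| <= 2 * 2^-1 ^+ n - 2 * 2^-1 ^+ (n + m).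
  elim: m => [|m IH]; first by rewrite addn0 !subrr normr0.
  rewrite -(subrKA (u (n + m)%N)) (le_trans (ler_normD _ _))//.
  by rewrite addnS half; have := u_cauchy (n + m)%N; lra.
pose v k (x : T) : R := `|U k.+1 x - U k x|.
pose G N (x : T) : R := \sum_(k < N) v k x.
have mv k : measurable_fun [set: T] (v k).
  by apply: (measurableT_comp (@normr_measurable R [set: R])); exact: mUD.
have mG N : measurable_fun [set: T] (G N).
  by apply: measurable_sum => k; exact: mv.
have G_le N : ('N[G N] <= (2 - 2 * 2^-1 ^+ N)%:E)%E.
  elim: N => [|N IH].
    rewrite expr0 mulr1 subrr (_ : G 0%N = cst 0); last first.
      by apply/funext => x; rewrite /G big_ord0.
    by rewrite Lnorm0// eqe gt_eqF.
  rewrite (_ : G N.+1 = (G N \+ v N)); last first.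
    by apply/funext => x; rewrite /G big_ord_recr.
  rewrite (le_trans (eminkowski _ (mG N) (mv N) r1))//.
  have -> : 'N[v N] = `|u N.+1 - u N|%:E.
    by rewrite -UDE -[RHS]Lnorm_abse; apply: eq_Lnorm.
  apply: (@le_trans _ _ ((2 - 2 * 2^-1 ^+ N)%:E + (2^-1 ^+ N)%:E)%E).
    by apply: leeD => //; rewrite lee_fin u_cauchy.
  by rewrite -EFinD lee_fin half; lra.
have Gfin : {ae mu, forall x, exists M, forall N, G N x <= M}.
  have : mu.-integrable [set: T] (fun x => limn_einf (fun n => (`|G n x| `^ r)%:E)).
    apply/integrableP; split; first exact: measurable_einf_pow.
    under eq_integral do rewrite gee0_abs ?einf_pow_ge0//.
    apply: le_lt_trans (fatou_bound (ler0n _ 2) mG _) (ltry _).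
    move=> n; apply: le_trans (G_le n) _.
    by rewrite lee_fin lerBlDr lerDl mulr_ge0// exprn_ge0.
  move/(integrable_ae measurableT); apply: filterS => x /(_ I) fx.
  exists ((fine (limn_einf (fun n => (`|G n x| `^ r)%:E))) `^ r^-1) => N.
  have G0 n : 0 <= G n x by apply: sumr_ge0 => k _; exact: normr_ge0.
  rewrite -[leLHS]powRr1// -(mulfV (lt0r_neq0 r_gt0)) powRrM.
  apply: ge0_ler_powR; rewrite ?nnegrE ?powR_ge0//.
  - by rewrite invr_ge0 ltW.
  - by apply: fine_ge0; exact: einf_pow_ge0.
  rewrite -lee_fin fineK// limn_einf_lim.
  apply: lime_ge; first exact: is_cvg_einfs.
  exists N => // n /= Nn; apply: le_ereal_inf_tmp => _ [k /= nk <-].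
  rewrite lee_fin (ger0_norm (G0 _)).
  apply: ge0_ler_powR; rewrite ?nnegrE//; first exact: ltW.
  rewrite /G -!(big_mkord xpredT (fun k => v k x)).
  apply: (@nondecreasing_series _ (fun k => v k x) xpredT 0%N _ _ _ (leq_trans Nn nk)).
  by move=> j _ _; exact: normr_ge0.
have Ucvg : {ae mu, forall x, cvgn (U ^~ x)}.
  apply: filterS Gfin => x [M GM].
  have : cvgn (series (telescope (U ^~ x))).
    apply: normed_cvg; apply: nondecreasing_is_cvgn.
      by apply: nondecreasing_series => j _ _; exact: normr_ge0.
    exists M => _ [n _ <-]; have := GM n.
    by rewrite /G -(big_mkord xpredT (fun k => v k x)).
  move=> Sc; rewrite (_ : U ^~ x = (fun n => U 0%N x + series (telescope (U ^~ x)) n)).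
    by apply: is_cvgD => //; exact: is_cvg_cst.
  by apply/funext => n; rewrite -eq_sum_telescope.
pose g0 x := fine (limn_esup (fun n => (U n x)%:E)).
have mg0 : measurable_fun [set: T] g0.
  apply: (@measurableT_comp _ _ _ _ _ _ (@fine R)) => //.
  by apply: measurable_fun_limn_esup => n; exact/measurable_EFinP.
have Ug0 : {ae mu, forall x, U ^~ x @ \oo --> g0 x}.
  apply: filterS Ucvg => x Ux; rewrite /g0.
  have /cvg_limn_einf_sup[_ ->] : (fun n => (U n x)%:E) @ \oo --> (limn (U ^~ x))%:E.
    by apply: cvg_EFin; first exact: nearW.
  exact: Ux.
have g0U n : ('N[fun x => g0 x - U n x] <= (2 * 2^-1 ^+ n)%:E)%E.
  apply: (@fatou_Lnorm (fun m x => U (n + m)%N x - U n x)) => //.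
  - exact: measurable_funB.
  - move=> m; rewrite UDE lee_fin (le_trans (norm_tail _ _))//.
    by rewrite gerBl mulr_ge0// exprn_ge0.
  - apply: filterS Ug0 => x xg0; apply: cvgB; last exact: cvg_cst.
    rewrite (_ : (fun m => _) = (fun m => U (m + n)%N x)).
      by rewrite (cvg_shiftn n (U ^~ x)).
    by apply/funext => m; rewrite addnC.
have g0_Lfun : g0 \in Lfun mu r%:E.
  rewrite inE; apply/andP; split; apply: mem_set => //=.
  rewrite /finite_norm (_ : g0 = (fun x => g0 x - U 0%N x) \+ U 0%N); last first.
    by apply/funext => x /=; rewrite subrK.
  apply: le_lt_trans (eminkowski _ _ (mU 0%N) r1) _.
    exact: measurable_funB.
  rewrite lte_add_pinfty//; first exact: le_lt_trans (g0U 0%N) (ltry _).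
  exact: Lebesgue_finite.
exists (Lclass (Lfun_Sub r1 g0_Lfun)) => n.
rewrite -lee_fin -[in leLHS](Lrepr_ae (u n)) -LclassN -LclassD.
by rewrite [leLHS]Lspace_normE; exact: g0U.
Qed.

Let Lspace_cauchy_cvg (F : set_system Lspace) :
  ProperFilter F -> cauchy F -> cvg F.
Proof.
move=> FF /cauchyP Fc.
have e_gt0 n : 0 < 2^-1 ^+ n / 2 :> R by rewrite divr_gt0// exprn_gt0.
have /choice[u Fu] : forall n, exists x, F (ball x (2^-1 ^+ n / 2)).
  by move=> n; exact: Fc (e_gt0 n).
have u_cauchy n : `|u n.+1 - u n| <= 2^-1 ^+ n.
  have [y []] := filter_ex (filterI (Fu n.+1) (Fu n)).
  rewrite -!ball_normE /ball_/= => yn1 yn.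
  rewrite -(subrKA y) (le_trans (ler_normD _ _))// -(distrC (u n)).
  rewrite (le_trans (lerD (ltW yn1) (ltW yn)))//.
  rewrite [leRHS]splitr lerD2r ler_wpM2r// exprS ler_piMl ?exprn_ge0//.
  by rewrite invf_le1// ler1n.
have [g gu] := ccauchy_cvg u_cauchy.
apply/cvg_ex; exists g; apply/cvgrPdist_lt => e e0.
have : (fun n => 3 * 2^-1 ^+ n : R) @ \oo --> (3 * 0 : R).
  by apply: cvgM; [exact: cvg_cst|apply: cvg_expr; rewrite ger0_norm// invf_lt1// ltr1n].
rewrite mulr0 => /cvgrPdist_lt/(_ _ e0)[n _ /(_ n (leqnn n))].
rewrite /= sub0r normrN ger0_norm ?mulr_ge0 ?exprn_ge0// => ne.
apply: filterS (Fu n) => y; rewrite -ball_normE /ball_/= => yn.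
rewrite -(subrKA (u n)) (le_lt_trans (ler_normD _ _))//.
apply: lt_trans ne; rewrite (le_lt_trans (lerD (gu n) (ltW yn)))//.
have := exprn_gt0 n (_ : 0 < 2^-1 :> R); rewrite invr_gt0 ltr0n => /(_ isT).
lra.
Qed.

HB.instance Definition _ := Uniform_isComplete.Build Lspace Lspace_cauchy_cvg.

End Riesz_Fischer.

Section Lspace_restriction.
Context d (T : measurableType d) (R : realType).
Variables (mu : {measure set T -> \bar R}) (r : R) (r1 : (1 <= r%:E)%E).

Local Notation Lspace := (LspaceType mu r1).

Fact Lrestrict_subproof (A : set T) (mA : measurable A) (f : Lspace) :
  (fun t => if t \in A then (f : T -> R) t else 0) \in Lfun mu r%:E.
Proof.
have r0 : 0 < r by apply: (@lt_le_trans _ _ 1); rewrite // -lee_fin.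
have mf : measurable_fun [set: T] (f : T -> R) by exact: measurable_ae_class.
have mg : measurable_fun [set: T]
    (fun t => if t \in A then (f : T -> R) t else 0).
  apply: measurable_fun_ifT => //.
  by apply: (measurable_fun_bool true); rewrite setTI preimage_mem_true.
have mpow (h : T -> R) : measurable_fun [set: T] h ->
    measurable_fun [set: T] (fun x => `|(EFin \o h) x| `^ r)%E.
  move=> mh.
  apply: (@measurableT_comp _ _ _ _ _ _ (fun x : \bar R => x `^ r)%E) => //=.
    exact: (measurableT_comp (measurable_poweR _)).
  by apply: measurableT_comp => //; exact: measurableT_comp.
rewrite inE; apply/andP; split; apply: mem_set => //=.
have ff : ('N[mu]_r%:E[EFin \o (f : T -> R)] < +oo)%E.
  exact: Lebesgue_finite.
rewrite /finite_norm; apply: le_lt_trans ff.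
rewrite unlock /Lnorm; apply: gt0_ler_poweR.
- by rewrite invr_ge0 ltW.
- by rewrite in_itv/= leey andbT integral_ge0// => x _; exact: poweR_ge0.
- by rewrite in_itv/= leey andbT integral_ge0// => x _; exact: poweR_ge0.
- apply: ge0_le_integral => //.
  + by move=> x _; exact: poweR_ge0.
  + exact: mpow.
  + exact: mpow.
  + move=> x _ /=; case: ifP => // _; rewrite normr0 powR0 ?gt_eqF//.
    by rewrite lee_fin powR_ge0.
Qed.

Definition Lrestrict (A : set T) (mA : measurable A) (f : Lspace) : Lspace :=
  Lclass (Lfun_Sub r1 (Lrestrict_subproof mA f)).

Lemma LrestrictE (A : set T) (mA : measurable A) (f : Lspace) :
  (Lrestrict mA f : T -> R)
  = (fun t => if t \in A then (f : T -> R) t else 0) %[ae mu].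
Proof. exact: LclassE. Qed.

End Lspace_restriction.
Arguments Lrestrict {d T R} mu {r} r1 {A} mA f.

Section lebesgue01.
Variable R : realType.

(* R with the sigma-algebra of all Lebesgue-measurable sets (the library's own
   instance on R is the Borel one). *)
Definition lebesgueType : measurableType _ :=
  caratheodory_type (mu_ext (wlength (@idfun R))).

Lemma measurable_itv01 : measurable (`]0, 1[%classic : set lebesgueType).
Proof.
apply: (@sub_caratheodory _ _ _ (wlength (@idfun R))).
exact: (@measurable_itv R `]0, 1[).
Qed.

(* Lebesgue measure on (0,1), realized as a measure on R that does not charge
   the complement of (0,1): two functions that agree on (0,1) are equal almost
   everywhere, so that `LspaceType lebesgue01 p1` is L_p(0,1). *)
Definition lebesgue01 : {measure set lebesgueType -> \bar R} :=
  mrestr (@completed_lebesgue_measure R) measurable_itv01.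
End lebesgue01.

Section Schauder.
Context (R : realType) (X : completeNormedModType R).
Implicit Types (M : nat -> set X) (x : X) (Phi : R -> R).

Definition schauder_expansion M x (x_ : nat -> X) : Prop :=
  (forall n, M n (x_ n)) /\ series x_ @ \oo --> x.

Definition schauder_decomposition M : Prop :=
  (forall n, [/\ submod_closed (mem (M n) : {pred X}), closed (M n)
               & exists2 x, M n x & x != 0]) /\
  (forall x, exists! x_ : nat -> X, schauder_expansion M x x_).

(* Meaningful when M is a Schauder decomposition: `get` then returns the unique
   expansion of x. *)
Definition coordinate_projection M (n : nat) x : X :=
  get (schauder_expansion M x) n.

(* An Orlicz function is only defined on [0, +oo[; the values of Phi at negative
   arguments are irrelevant here and below. *)
Definition orlicz_function Phi : Prop :=
  [/\ forall t, 0 <= t -> 0 <= Phi t,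
      {within `[0, +oo[, continuous Phi},
      {in `[0, +oo[ &, {homo Phi : s t / s <= t}},
      convex_function (`[0, +oo[%classic : set R) Phi &
      Phi 0 = 0 /\ Phi t @[t --> +oo] --> +oo].

(* ereal_inf so that an empty set of admissible rho yields +oo and not 0. *)
Definition schauder_orlicz_decomposition M Phi : Prop :=
  [/\ schauder_decomposition M, orlicz_function Phi
    & forall x, ereal_inf [set rho%:E | rho in [set rho : R | 0 < rho /\
        (\sum_(0 <= n <oo) (Phi (`|coordinate_projection M n x| / rho))%:E
          <= 1)%E]] = `|x|%:E].
End Schauder.

(* Main.v *)
From HB Require Import structures.
Require Import Defs.
From mathcomp Require Import all_boot all_order all_algebra.
From mathcomp Require Import all_classical all_reals all_analysis.
From mathcomp Require Import measurable_realfun.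

Set Implicit Arguments.
Unset Strict Implicit.
Unset Printing Implicit Defensive.

Import Order.TTheory GRing.Theory Num.Theory.
Import numFieldNormedType.Exports.

Local Open Scope classical_set_scope.
Local Open Scope ring_scope.

(** The p-th power of the L^p norm is the integral of a nonnegative function,
    hence additive over a countable partition of the space.  For the
    restrictions P_n f of f to the pieces A_n this gives the identity
      sum_n |P_n f|^p = |f|^p                     ([sum_Lrestrict_norm_pow]),
    and the whole result follows from it.

    The Luxemburg norm for the function t^p of a sequence b is its l^p norm: the
    constraint sum_n (b_n / rho)^p <= 1 says that rho is at least that norm
    ([ereal_inf_luxemburg]).  With b_n = |P_n f| the identity turns it into |f|.

    The series of the P_n f converges to f because the remainder after n terms
    is the restriction of f to the union of the remaining pieces, whose p-th
    power norm is the tail of the convergent series above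
    ([cvg_series_Lrestrict]).  The P_n are moreover norm-nonincreasing linear
    projections, mutually annihilating because the pieces are disjoint, and
    nonzero because the pieces have positive measure; applying P_k to any
    expansion of f isolates its k-th term, so expansions are unique
    ([schauder_decomposition_proj]).

    All this holds for a countable partition, up to a null set, of any measure
    space into pieces of positive finite measure
    ([schauder_orlicz_Lrestrict]). *)

(** * Schauder decompositions from mutually annihilating projections *)

Section Projections.
Context (R : realType) (X : completeNormedModType R).
Variable P : nat -> {linear X -> X}.
Hypothesis P_continuous : forall n, continuous (P n).
Hypothesis P_idem : forall n x, P n (P n x) = P n x.
Hypothesis P_ortho : forall i j x, i != j -> P i (P j x) = 0.
Hypothesis P_neq0 : forall n, exists x, P n x != 0.
Hypothesis P_series : forall x, series (fun n => P n x) @ \oo --> x.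

Local Notation M := (fun n => range (P n)).

Lemma range_projE n x : range (P n) x <-> P n x = x.
Proof. by split=> [[y _ <-]|<-]; [exact: P_idem|exists x]. Qed.

Lemma schauder_expansion_proj x : schauder_expansion M x (fun n => P n x).
Proof. by split=> [n|//]; exists x. Qed.

(** Since P_k is continuous, it can be applied to the expansion term by term; it
    fixes the k-th term and kills the others, so that the sequence of images of
    the partial sums is eventually the k-th term. *)
Lemma schauder_expansion_unique x x_ :
  schauder_expansion M x x_ -> x_ = fun n => P n x.
Proof.
move=> [Mx_ x_x]; apply/funext => k.
have Px_ : P k \o series x_ @ \oo --> P k x.
  by apply: cvg_comp; [exact: x_x|exact: P_continuous].
rewrite -(cvg_lim _ Px_)//; apply/esym/cvg_lim => //.
apply: cvg_near_cst; exists k.+1 => // n /= kn.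
rewrite linear_sum (bigD1_seq k)/= ?mem_index_iota ?iota_uniq//.
have /range_projE -> := Mx_ k.
rewrite big1 ?addr0// => i ik; have [y _ <-] := Mx_ i.
by rewrite P_ortho// eq_sym.
Qed.

Lemma schauder_decomposition_proj : schauder_decomposition M.
Proof.
split=> [n|x].
  split.
  - have in_range x : (x \in (mem (range (P n)) : {pred X})) = (P n x == x).
      by apply/idP/eqP => [|]; rewrite inE => /range_projE.
    split=> [|a u v]; first by rewrite in_range linear0.
    by rewrite !in_range linearP => /eqP -> /eqP ->.
  (* The range of a continuous projection is the kernel of a continuous map. *)
  - rewrite (_ : range (P n) = (fun x => P n x - x) @^-1` [set 0]).
      apply: preimage_closed => [x _|].
        by apply: cvgB; [exact: P_continuous|exact: cvg_id].
      exact/accessible_closed_set1/hausdorff_accessible.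
    apply/seteqP; split=> x /= => [/range_projE ->|/eqP]; first exact: subrr.
    by rewrite subr_eq0 => /eqP/range_projE.
  - by have [x Px] := P_neq0 n; exists (P n x) => //; exists x.
exists (fun n => P n x); split; first exact: schauder_expansion_proj.
by move=> x_ /schauder_expansion_unique.
Qed.

Lemma coordinate_projectionE n x : coordinate_projection M n x = P n x.
Proof.
rewrite /coordinate_projection; case: xgetP => [x_ _|/(_ (fun n => P n x))[]].
  by move=> /schauder_expansion_unique ->.
exact: schauder_expansion_proj.
Qed.

End Projections.

(** * The Orlicz function t^p and its Luxemburg norm *)

Section Orlicz_power.
Variables (R : realType) (p : R).
Hypothesis p1 : 1 <= p.

Let p0 : 0 < p. Proof. exact: lt_le_trans p1. Qed.

Lemma orlicz_function_powR : orlicz_function (fun t : R => t `^ p).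
Proof.
split.
- by move=> t _; exact: powR_ge0.
- apply/continuous_within_itvcyP; split=> [t t0|].
    apply: differentiable_continuous; apply/derivable1_diffP.
    exact: derivable_powR.
  by rewrite powR0 ?gt_eqF//; exact: powR_cvg0.
- move=> s t; rewrite !in_itv/= !andbT => s0 t0.
  by apply: ge0_ler_powR; rewrite ?nnegrE// ltW.
- exact: convex_powR.
- split; first by rewrite powR0 ?gt_eqF.
  apply/cvgryPge => a; near=> t.
  have t1 : 1 <= t by near: t; apply: nbhs_pinfty_ge; rewrite ?num_real.
  apply: (@le_trans _ _ t); first by near: t; apply: nbhs_pinfty_ge; rewrite ?num_real.
  by rewrite -[leLHS]powRr1 ?(le_trans ler01)// ler_powR.
Unshelve. all: by end_near. Qed.

(** By homogeneity the constraint on rho reads (a / rho)^p <= 1, i.e.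
    a <= rho.  The infimum is not attained when a = 0, since rho must be
    positive. *)
Lemma ereal_inf_luxemburg (a : R) (b : nat -> R) : 0 <= a ->
  (forall n, 0 <= b n) ->
  (\sum_(0 <= n <oo) (b n `^ p)%:E)%E = (a `^ p)%:E ->
  ereal_inf [set rho%:E | rho in [set rho : R | 0 < rho /\
    (\sum_(0 <= n <oo) ((b n / rho) `^ p)%:E <= 1)%E]] = a%:E.
Proof.
move=> a0 b0 ab.
have sumE rho : 0 < rho ->
    ((\sum_(0 <= n <oo) ((b n / rho) `^ p)%:E <= 1)%E) = (a <= rho).
  move=> rho0.
  have -> : (\sum_(0 <= n <oo) ((b n / rho) `^ p)%:E = ((a / rho) `^ p)%:E)%E.
    rewrite powRM ?invr_ge0 ?(ltW rho0)// mulrC EFinM -ab -nneseriesZl.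
      apply: eq_eseriesr => n _.
      by rewrite powRM ?invr_ge0 ?(ltW rho0)// mulrC EFinM.
    by move=> n _; rewrite lee_fin powR_ge0.
  rewrite lee_fin -[X in _ <= X](_ : 1 `^ p = 1); last by rewrite powR1.
  rewrite -[in RHS](mul1r rho) -ler_pdivrMr//.
  apply/idP/idP; last first.
    by move=> ?; apply: ge0_ler_powR; rewrite ?nnegrE ?divr_ge0// ltW.
  apply: contraTT; rewrite -!ltNge => ?.
  by apply: gt0_ltr_powR; rewrite ?nnegrE ?divr_ge0// ltW.
apply/eqP; rewrite eq_le; apply/andP; split.
  apply/lee_addgt0Pr => e e0; apply: ereal_inf_lbound.
  exists (a + e) => //=; split; first by rewrite ltr_wpDl.
  by rewrite sumE ?lerDl ?ltW// ltr_wpDl.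
apply: le_ereal_inf_tmp => _ [rho [rho0]] + <-.
by rewrite sumE// lee_fin.
Qed.

End Orlicz_power.

(** * Restriction operators on L^p *)

Section Restriction.
Context d (T : measurableType d) (R : realType).
Variables (mu : {measure set T -> \bar R}) (r : R) (r1 : (1 <= r%:E)%E).

Local Notation Lspace := (LspaceType mu r1).
Implicit Types (f g : Lspace) (A B C : set T).

Let r_ge1 : 1 <= r. Proof. by rewrite -lee_fin. Qed.
Let r_gt0 : 0 < r. Proof. exact: lt_le_trans r_ge1. Qed.

Lemma LspaceDE f g : (f + g : T -> R)
  = (fun t => (f : T -> R) t + (g : T -> R) t) %[ae mu].
Proof. exact: LclassE. Qed.

Lemma LspaceZE a f : (a *: f : T -> R) = (fun t => a * (f : T -> R) t) %[ae mu].
Proof. exact: LclassE. Qed.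

Lemma Lspace0E : ((0 : Lspace) : T -> R) = (fun=> 0) %[ae mu].
Proof. exact: LclassE. Qed.

Lemma measurable_norm_pow f :
  measurable_fun [set: T] (fun t => (`|(f : T -> R) t| `^ r)%:E).
Proof.
apply/measurable_EFinP.
apply: (@measurableT_comp _ _ _ _ _ _ (fun x : R => x `^ r)) => //.
by apply: measurableT_comp => //; exact: measurable_ae_class.
Qed.

Lemma Lspacenorm_powE f :
  (`|f| `^ r)%:E = (\int[mu]_t (`|(f : T -> R) t| `^ r)%:E)%E.
Proof.
by rewrite -poweR_EFin LspacenormE poweR_Lnorm ?gt_eqF//.
Qed.

Lemma Lrestrict_norm_powE A (mA : measurable A) f :
  (`|Lrestrict mu r1 mA f| `^ r)%:E
  = (\int[mu]_(t in A) (`|(f : T -> R) t| `^ r)%:E)%E.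
Proof.
rewrite Lspacenorm_powE [RHS]integral_mkcond; apply: ge0_ae_eq_integral => //.
- exact: measurable_norm_pow.
- apply/(measurable_restrictT _ mA); apply: measurable_funTS.
  exact: measurable_norm_pow.
- by move=> t _; rewrite /patch; case: ifP => // _; rewrite lee_fin powR_ge0.
apply: filterS (LrestrictE mA f) => t + _ => /(_ I) ->.
by rewrite /patch; case: ifP => // _; rewrite normr0 powR0 ?gt_eqF.
Qed.

Lemma Lrestrict_linear A (mA : measurable A) : linear (Lrestrict mu r1 mA).
Proof.
move=> a f g; apply/Lspace_eqP/(ae_eq_trans (LrestrictE mA _)).
apply: ae_eq_trans (ae_eq_sym (LspaceDE _ _)).
near=> t => _.
rewrite (near (LspaceDE (a *: f) g) t)// (near (LspaceZE a f) t)//.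
rewrite (near (LspaceZE a (Lrestrict mu r1 mA f)) t)//.
rewrite (near (LrestrictE mA f) t)// (near (LrestrictE mA g) t)//.
by case: ifP => // _; rewrite mulr0 addr0.
Unshelve. all: by end_near. Qed.

HB.instance Definition _ A (mA : measurable A) :=
  GRing.isLinear.Build R Lspace Lspace _ (Lrestrict mu r1 mA)
    (Lrestrict_linear mA).

Lemma le_Lrestrict_norm A (mA : measurable A) f : `|Lrestrict mu r1 mA f| <= `|f|.
Proof.
have : ((`|Lrestrict mu r1 mA f| `^ r)%:E <= (`|f| `^ r)%:E)%E.
  rewrite Lrestrict_norm_powE Lspacenorm_powE; apply: ge0_subset_integral => //.
  exact: measurable_norm_pow.
rewrite lee_fin; apply: contraTT; rewrite -!ltNge => ?.
by apply: gt0_ltr_powR; rewrite ?nnegrE.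
Qed.

Lemma Lrestrict_continuous A (mA : measurable A) :
  continuous (Lrestrict mu r1 mA).
Proof.
apply: (@bounded_linear_continuous _ _ _ (Lrestrict mu r1 mA)).
apply/bounded_funP => e; exists e => f.
exact/le_trans/le_Lrestrict_norm.
Qed.

(** The set C is a parameter, rather than the intersection itself, so that no
    choice of a measurability proof for the intersection is imposed. *)
Lemma Lrestrict_comp A B C (mA : measurable A) (mB : measurable B)
    (mC : measurable C) f : C = A `&` B ->
  Lrestrict mu r1 mA (Lrestrict mu r1 mB f) = Lrestrict mu r1 mC f.
Proof.
move=> CAB; apply/Lspace_eqP/(ae_eq_trans (LrestrictE mA _)).
apply: ae_eq_trans (ae_eq_sym (LrestrictE mC _)).
apply: filterS (LrestrictE mB f) => t + _ => /(_ I) ->.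
by rewrite CAB in_setI; case: (t \in A).
Qed.

Lemma Lrestrict_disjU A B C (mA : measurable A) (mB : measurable B)
    (mC : measurable C) f : C = A `|` B -> A `&` B = set0 ->
  Lrestrict mu r1 mC f = Lrestrict mu r1 mA f + Lrestrict mu r1 mB f.
Proof.
move=> CAB AB0; apply/Lspace_eqP/(ae_eq_trans (LrestrictE mC _)).
apply: ae_eq_trans (ae_eq_sym (LspaceDE _ _)).
near=> t => _.
rewrite (near (LrestrictE mA f) t)// (near (LrestrictE mB f) t)//.
rewrite CAB in_setU; have : t \notin A `&` B by rewrite AB0 in_set0.
rewrite in_setI negb_and.
by case: (t \in A) (t \in B) => [] []//= _; rewrite ?add0r ?addr0.
Unshelve. all: by end_near. Qed.

Lemma Lrestrict_eq0 A (mA : measurable A) f : A = set0 -> Lrestrict mu r1 mA f = 0.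
Proof.
move=> A0; apply/Lspace_eqP/(ae_eq_trans (LrestrictE mA _)).
apply: filterS Lspace0E => t + _ => /(_ I) ->.
by rewrite A0 in_set0.
Qed.

Lemma Lrestrict_full A (mA : measurable A) f :
  mu (~` A) = 0%E -> Lrestrict mu r1 mA f = f.
Proof.
move=> A0; apply/Lspace_eqP/(ae_eq_trans (LrestrictE mA _)).
exists (~` A); split => //; first exact: measurableC.
by move=> t /=; apply: contra_not => At _; rewrite mem_set.
Qed.

(** The indicator function of A is fixed by the restriction to A, and the p-th
    power of its norm is the measure of A. *)
Lemma exists_Lrestrict_neq0 A (mA : measurable A) :
  (0 < mu A)%E -> (mu A < +oo)%E -> exists f, Lrestrict mu r1 mA f != 0.
Proof.
move=> muA0 muAoo.
have powE t : `|\1_A t| `^ r = \1_A t :> R.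
  by rewrite indicE; case: (_ \in _); rewrite ?normr1 ?powR1// normr0 powR0 ?gt_eqF.
have L1 : (\1_A : T -> R) \in Lfun mu r%:E.
  rewrite inE; apply/andP; split; apply: mem_set => //=.
  rewrite /finite_norm unlock /Lnorm poweR_lty//.
  under eq_integral do rewrite /= powE.
  by rewrite integral_indic// setIT.
have LE := LclassE (Lfun_Sub r1 L1).
exists (Lclass (Lfun_Sub r1 L1)); apply/eqP => L0.
have := Lrestrict_norm_powE mA (Lclass (Lfun_Sub r1 L1)).
rewrite L0 normr0 powR0 ?gt_eqF// (ae_eq_integral (EFin \o \1_A)) //.
- by rewrite integral_indic// setIid => muA; rewrite -muA ltxx in muA0.
- exact: measurable_funTS (measurable_norm_pow _).
- by apply: measurable_funTS; apply/measurable_EFinP; exact: measurable_indic.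
by apply: filterS LE => t /= + _ => /(_ I) ->; rewrite powE.
Qed.

End Restriction.

(** * Restrictions to the pieces of a partition *)

Section Partition.
Context d (T : measurableType d) (R : realType).
Variables (mu : {measure set T -> \bar R}) (r : R) (r1 : (1 <= r%:E)%E).
Variable A : nat -> set T.
Hypothesis mA : forall n, measurable (A n).
Hypothesis A_disjoint : forall i j, i != j -> A i `&` A j = set0.
Hypothesis A_cover : mu (~` \bigcup_n A n) = 0%E.

Local Notation Lspace := (LspaceType mu r1).
Implicit Types (f : Lspace).

Let r_ge1 : 1 <= r. Proof. by rewrite -lee_fin. Qed.
Let r_gt0 : 0 < r. Proof. exact: lt_le_trans r_ge1. Qed.

Let tail n := \bigcup_k A (k + n).

Let mtail n : measurable (tail n). Proof. exact: bigcup_measurable. Qed.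

(** Countable additivity of the integral. The tails serve both the convergence
    of the series of restrictions and, for n = 0, the norm identity. *)
Lemma Lrestrict_tail_powE n f :
  (`|Lrestrict mu r1 (mtail n) f| `^ r)%:E
  = (\sum_(n <= k <oo) (`|Lrestrict mu r1 (mA k) f| `^ r)%:E)%E.
Proof.
rewrite -nneseries_addn; last by move=> k; rewrite lee_fin powR_ge0.
rewrite Lrestrict_norm_powE ge0_integral_bigcup//.
- by apply: eq_eseriesr => k _; rewrite Lrestrict_norm_powE.
- exact: measurable_funTS (measurable_norm_pow _).
- by apply/trivIsetP => i j _ _ ij; apply: A_disjoint; rewrite eqn_add2r.
Qed.

Let tail0 f : Lrestrict mu r1 (mtail 0) f = f.
Proof.
by apply: Lrestrict_full; rewrite /tail; under eq_bigcupr do rewrite addn0.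
Qed.

Lemma sum_Lrestrict_norm_pow f :
  (\sum_(0 <= k <oo) (`|Lrestrict mu r1 (mA k) f| `^ r)%:E = (`|f| `^ r)%:E)%E.
Proof. by rewrite -Lrestrict_tail_powE tail0. Qed.

Lemma series_Lrestrict_tail n f :
  f = series (fun k => Lrestrict mu r1 (mA k) f) n + Lrestrict mu r1 (mtail n) f.
Proof.
elim: n => [|n {1}->]; first by rewrite seriesEnat/= big_geq// add0r tail0.
rewrite !seriesEnat/= big_nat_recr//= -addrA; congr (_ + _).
apply: Lrestrict_disjU.
  apply/seteqP; split=> t.
    move=> [[|k] _]; rewrite ?add0n; first by left.
    by rewrite addSnnS; right; exists k.
  by move=> [At|[k _]]; [exists 0%N|rewrite -addSnnS; exists k.+1].
apply/seteqP; split=> // t [At [k _ Akt]].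
by rewrite -(@A_disjoint n (k + n.+1)%N)// neq_ltn addnS ltnS leq_addl.
Qed.

Lemma cvg_series_Lrestrict f :
  series (fun k => Lrestrict mu r1 (mA k) f) @ \oo --> f.
Proof.
have : (fun n => (`|Lrestrict mu r1 (mtail n) f| `^ r)%:E) @ \oo --> 0%E.
  under eq_fun do rewrite Lrestrict_tail_powE.
  apply: nneseries_tail_cvg; last by move=> k _; rewrite lee_fin powR_ge0.
  by rewrite sum_Lrestrict_norm_pow ltry.
move/fine_cvgP => [_ /cvgrPdist_lt tail_cvg0]; apply/cvgrPdist_lt => e e0.
have := tail_cvg0 (e `^ r) (powR_gt0 r e0); apply: filterS => n /=.
rewrite sub0r normrN ger0_norm ?powR_ge0//.
have -> : f - series (fun k => Lrestrict mu r1 (mA k) f) n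
    = Lrestrict mu r1 (mtail n) f.
  by rewrite {1}(series_Lrestrict_tail n f) addrC addKr.
by apply: contraTT; rewrite -!leNgt => ?; apply: ge0_ler_powR;
  rewrite ?nnegrE// ltW.
Qed.

Hypothesis A_pos : forall n, (0 < mu (A n) < +oo)%E.

Theorem schauder_orlicz_Lrestrict :
  schauder_orlicz_decomposition
    (fun n => range (Lrestrict mu r1 (mA n))) (fun t : R => t `^ r).
Proof.
pose P n : {linear Lspace -> Lspace} := Lrestrict mu r1 (mA n).
have P_cont n : continuous (P n) by exact: Lrestrict_continuous.
have P_idem n f : P n (P n f) = P n f.
  by rewrite /P/= (Lrestrict_comp _ _ (mA n))// setIid.
have P_ortho i j f : i != j -> P i (P j f) = 0.
  move=> /A_disjoint Aij0; rewrite /P/= (Lrestrict_comp _ _ measurable0)//.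
  exact: Lrestrict_eq0.
have P_neq0 n : exists f, P n f != 0.
  by have /andP[A0 Aoo] := A_pos n; exact: exists_Lrestrict_neq0.
have P_series : forall f, series (fun n => P n f) @ \oo --> f.
  exact: cvg_series_Lrestrict.
split.
- exact: (schauder_decomposition_proj P_cont).
- exact: orlicz_function_powR.
- move=> f; under eq_set do under eq_eseriesr do
    rewrite (coordinate_projectionE P_cont)//.
  by apply: ereal_inf_luxemburg => //; exact: sum_Lrestrict_norm_pow.
Qed.

End Partition.

(** * Lebesgue measure on the unit interval *)

(** The Caratheodory extension of the length function agrees by definition with
    Lebesgue measure on Borel sets, hence the total mass is the length 1. *)
Lemma lebesgue01_lty (R : realType) (A : set (lebesgueType R)) :
  measurable A -> (lebesgue01 R A < +oo)%E.
Proof.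
move=> mA; apply: (@le_lt_trans _ _ (lebesgue01 R setT)).
  by apply: le_measure; rewrite ?inE.
suff -> : lebesgue01 R setT = lebesgue_measure (`]0, 1[%classic : set R).
  by rewrite lebesgue_measure_itv/= lte_fin ltr01 sube0 ltry.
by rewrite /lebesgue01/= /mrestr setTI.
Qed.

Theorem theorem18 (R : realType) (A : nat -> set (lebesgueType R))
    (mA : forall n, measurable (A n))
    (A_disjoint : forall i j : nat, i != j -> A i `&` A j = set0)
    (A_cover : \bigcup_n A n = (`]0, 1[%classic : set R))
    (A_pos : forall n, (0 < lebesgue01 R (A n))%E)
    (A_lim : lebesgue01 R (A n) @[n --> \oo] --> 0%E)
    (p : R) (p1 : (1 <= p%:E)%E) :
  schauder_orlicz_decomposition
    (fun n => range (Lrestrict (lebesgue01 R) p1 (mA n)))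
    (fun t : R => t `^ p).
Proof.
apply: schauder_orlicz_Lrestrict => // [|n]; last by rewrite A_pos lebesgue01_lty.
by rewrite A_cover /lebesgue01/= /mrestr setICl measure0.
Qed.
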